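(* For infinite time Turing machines, $\mathrm{NP} \neq \text{co-NP}$, where $\mathrm{NP} = NP_{\omega^\omega}$ and $\text{co-NP} = \{A \subset {}^{\omega}2 : {}^{\omega}2 \setminus A \in \mathrm{NP}\}$.
   Context: Infinite time Turing machines (Hamkins–Lewis): a machine has a finite program (finitely many states) and three one-way infinite tapes (input, scratch, output) with cells indexed by $\omega$, each cell holding $0$ or $1$, read by a single head that scans the same position on all three tapes. An input $x \in {}^{\omega}2$ is written on the input tape, the other tapes are initially all $0$, and the head starts at the leftmost cell in the start state. Successor steps of the computation proceed as for an ordinary Turing machine. At a limit ordinal stage the head is placed on the leftmost cell, the machine enters a designated limit state, and each cell takes as its value the limsup of its values at earlier stages. The machine halts when it enters a designated halt state. It accepts $x$ if it halts on input $x$ with output $1$. For $x,y \in {}^{\omega}2$, $x \oplus y \in {}^{\omega}2$ is the interleaving: $(x\oplus y)(2n)=x(n)$, $(x\oplus y)(2n+1)=y(n)$. For $A \subset {}^{\omega}2$ and an ordinal $\alpha \le \omega_1+1$: $A \in NP_\alpha$ if there are an infinite time Turing machine $T$ and some $\beta<\alpha$ such that (a) $x \in A$ if and only if there exists $y \in {}^{\omega}2$ such that $T$ accepts $x\oplus y$, and (b) $T$ halts on all inputs after $<\beta$ many steps. Here $\omega^\omega$ denotes ordinal exponentiation. *)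

(* Defs.v *)
From mathcomp Require Import all_boot.
From mathcomp Require Import boolp contra classical_sets cardinality wochoice.

Set Implicit Arguments.
Unset Strict Implicit.
Unset Printing Implicit Defensive.

Local Open Scope classical_set_scope.

(* An ordinal is represented by a well-ordered type of that order type; the
   elements of the type are then the ordinals strictly below it. *)
Record wellOrder := WellOrder {
  wo_sort :> Type;
  wo_le : rel wo_sort;
  wo_leP : well_order wo_le
}.

Definition wo_lt (W : wellOrder) (a b : W) : bool := ~~ wo_le b a.

Definition is_zero (W : wellOrder) (a : W) : Prop := forall b : W, wo_le a b.

Definition is_succ (W : wellOrder) (a b : W) : Prop :=
  wo_lt a b /\ forall c : W, wo_lt a c -> wo_le b c.

Definition is_limit (W : wellOrder) (l : W) : Prop :=
  ~ is_zero l /\ forall a : W, ~ is_succ a l.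

Section WellOrderTheory.
Variable W : wellOrder.
Implicit Types a b c : W.

Lemma wo_refl a : wo_le a a.
Proof.
have [|z [[/asboolP -> H] _]] := @wo_leP W (fun x => `[< x = a >]).
  by exists a; apply/asboolP.
by apply: H; apply/asboolP.
Qed.

Lemma wo_total a b : wo_le a b || wo_le b a.
Proof.
have [|z [[/asboolP zab H] _]] := @wo_leP W (fun x => `[< x = a \/ x = b >]).
  by exists a; apply/asboolP; left.
apply/orP; case: zab => zE; [left|right]; rewrite -zE;
  by apply: H; apply/asboolP; auto.
Qed.

Lemma wo_anti a b : wo_le a b -> wo_le b a -> a = b.
Proof.
move=> ab ba.
have [|z [_ zU]] := @wo_leP W (fun x => `[< x = a \/ x = b >]).
  by exists a; apply/asboolP; left.
rewrite -(zU a) ?(zU b) //; split; try (by apply/asboolP; auto);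
  by move=> x /asboolP[->|->] //; apply: wo_refl.
Qed.

Lemma wo_trans a b c : wo_le a b -> wo_le b c -> wo_le a c.
Proof.
move=> ab bc.
have [|z [[/asboolP zabc H] _]] :=
  @wo_leP W (fun x => `[< [\/ x = a, x = b | x = c] >]).
  by exists a; apply/asboolP; constructor 1.
have [Ha Hb Hc] : [/\ wo_le z a, wo_le z b & wo_le z c].
  by split; apply: H; apply/asboolP; [constructor 1|constructor 2|constructor 3].
case: zabc => zE; rewrite zE in Ha Hb Hc => //.
- by rewrite (wo_anti ab Ha).
- by rewrite -(wo_anti bc Hb).
Qed.

Lemma wo_ltW a b : wo_lt a b -> wo_le a b.
Proof. by rewrite /wo_lt; case/orP: (wo_total a b) => -> //. Qed.

Lemma wo_le_lt_trans a b c : wo_le a b -> wo_lt b c -> wo_lt a c.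
Proof. by move=> ab; apply: contra => ca; apply: wo_trans ab. Qed.

Lemma wo_lt_le_trans a b c : wo_lt a b -> wo_le b c -> wo_lt a c.
Proof. by move=> ab bc; apply: contra ab => ca; apply: wo_trans ca. Qed.

Lemma wo_ltgtE a b : [\/ wo_lt a b, a = b | wo_lt b a].
Proof.
case: (boolP (wo_le a b)) => ab; last by constructor 3.
case: (boolP (wo_le b a)) => ba; last by constructor 1.
by constructor 2; apply: wo_anti.
Qed.

Lemma wo_lt_wf : well_founded (fun a b : W => wo_lt a b).
Proof.
move=> a; apply: contrapT => Na.
have [|z [[/asboolP Nz H] _]] :=
  @wo_leP W (fun x => `[< ~ Acc (fun a b : W => wo_lt a b) x >]).
  by exists a; apply/asboolP.
apply: Nz; constructor => y yz; apply: contrapT => Ny.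
by move: yz; rewrite /wo_lt H //; apply/asboolP.
Qed.

Lemma is_zero_uniq a b : is_zero a -> is_zero b -> a = b.
Proof. by move=> za zb; apply: wo_anti. Qed.

Lemma zero_exists a : exists z : W, is_zero z.
Proof.
have [|z [[_ H] _]] := @wo_leP W xpredT; first by exists a.
by exists z => b; apply: H.
Qed.

Lemma finite_wo_max (A : set W) : finite_set A -> A !=set0 ->
  exists2 m, A m & forall j, A j -> wo_le j m.
Proof.
move=> /(@finite_seqP {classic W})[s ->] [x0 x0s]; move: x0 x0s.
elim: s => [//|y s IH] x0 _.
have [[x1 x1s]|Ns] := pselect (exists x1, [set` s] x1); last first.
  exists y => /=; first exact: mem_head.
  move=> j /=; rewrite inE => /orP[/eqP->|js]; first exact: wo_refl.
  by case: Ns; exists j.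
have [m ms mP] := IH x1 x1s.
case/orP: (wo_total y m) => ym.
  exists m => /=; first by rewrite inE; apply/orP; right.
  by move=> j /=; rewrite inE => /orP[/eqP->//|]; apply: mP.
exists y => /=; first exact: mem_head.
move=> j /=; rewrite inE => /orP[/eqP->|js]; first exact: wo_refl.
exact: wo_trans (mP _ js) ym.
Qed.

End WellOrderTheory.

Definition wo_omega : wellOrder.
Proof.
apply: (@WellOrder nat leq); apply: antisymmetric_well_order.
  exact: anti_leq.
move=> A [n An]; have exA : exists n, A n by exists n.
by exists (ex_minn exA); case: ex_minnP => m Am mP; split.
Defined.

(* Ordinal exponentiation a ^ b in its order-theoretic form: the functions from
   b to a with finite support, compared at the largest argument where they
   differ. *)
Section Exponentiation.
Variables a b : wellOrder.

Record exp_sort := ExpSort {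
  exp_fun :> b -> a;
  exp_fin : finite_set [set i | ~ is_zero (exp_fun i)]
}.

Definition exp_lt (f g : exp_sort) : Prop :=
  exists i : b, wo_lt (f i) (g i) /\ forall j : b, wo_lt i j -> f j = g j.

Definition exp_le : rel exp_sort := fun f g => `[< f = g \/ exp_lt f g >].

Lemma exp_ext (f g : exp_sort) : (forall i, f i = g i) -> f = g.
Proof.
case: f g => [f fP] [g gP] /= fg; have E : f = g by apply: funext.
by rewrite -E in gP *; congr ExpSort; apply: Prop_irrelevance.
Qed.

Lemma exp_total (f g : exp_sort) : [\/ f = g, exp_lt f g | exp_lt g f].
Proof.
have [fg|Nfg] := pselect (exists i, f i <> g i); last first.
  constructor 1; apply: exp_ext => i; apply: contrapT => N.
  by apply: Nfg; exists i.
have [m fgm mP] : exists2 m, f m <> g m & forall j, f j <> g j -> wo_le j m.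
  apply: (finite_wo_max (A := [set j | f j <> g j])) fg.
  apply: (@sub_finite_set _ _
    ([set i | ~ is_zero (f i)] `|` [set i | ~ is_zero (g i)])); last first.
    by rewrite finite_setU; split; apply: exp_fin.
  move=> j /= fgj; have [zf|] := pselect (is_zero (f j)); last by left.
  by right=> zg; apply: fgj; apply: is_zero_uniq.
have E j : wo_lt m j -> f j = g j.
  by move=> mj; apply: contrapT => /mP jm; move: mj; rewrite /wo_lt jm.
case: (wo_ltgtE (f m) (g m)) => [lt|//|lt].
  by constructor 2; exists m.
by constructor 3; exists m; split=> // j /E.
Qed.

Lemma exp_restr (f : exp_sort) (i : b) : exists h : exp_sort,
  (forall j, wo_le i j -> is_zero (h j)) /\ (forall j, wo_lt j i -> h j = f j).
Proof.
have [z zP] := zero_exists (f i).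
pose h j := if wo_le i j then z else f j.
have hP : finite_set [set j | ~ is_zero (h j)].
  apply: sub_finite_set (exp_fin f) => j /=; rewrite /h.
  by case: ifP.
exists (ExpSort hP); split=> j /= ij; rewrite /h; first by rewrite ij.
by rewrite (negbTE ij).
Qed.

Lemma not_lt_zero (x y : a) : is_zero y -> wo_lt x y -> False.
Proof. by move=> zy; rewrite /wo_lt zy. Qed.

Lemma exp_acc_step (i : b) :
  (forall h : exp_sort, (forall j, wo_le i j -> is_zero (h j)) -> Acc exp_lt h) ->
  forall f : exp_sort, (forall j, wo_lt i j -> is_zero (f j)) -> Acc exp_lt f.
Proof.
move=> H f zf.
have [h [zh hf]] := exp_restr f i.
have [x xE] : exists x, f i = x by exists (f i).
elim/(well_founded_ind (@wo_lt_wf a)): x f zf h zh hf xE => x IHx f zf h zh.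
have hA := H h zh.
elim: hA zh f zf => {}h _ IHh zh f zf hf xE.
constructor=> g [k [gk gE]].
case: (wo_ltgtE k i) => ki.
- have zg j : wo_lt i j -> is_zero (g j).
    by move=> ij; rewrite gE; [apply: zf|apply: wo_le_lt_trans (wo_ltW ki) ij].
  have [h' [zh' h'g]] := exp_restr g i.
  apply: (IHh h') => //; last by rewrite gE.
  exists k; split; first by rewrite h'g // hf.
  move=> j kj; case: (boolP (wo_le i j)) => ij.
    by apply: is_zero_uniq; [apply: zh'|apply: zh].
  by rewrite h'g // hf // gE.
- rewrite ki in gk gE.
  have zg j : wo_lt i j -> is_zero (g j) by move=> ij; rewrite gE //; apply: zf.
  have [h' [zh' h'g]] := exp_restr g i.
  by apply: (IHx (g i) _ g zg h' zh' h'g); rewrite // -xE.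
- by case: (not_lt_zero (zf k ki) gk).
Qed.

Lemma exp_acc_bounded (i : b) (f : exp_sort) :
  (forall j, wo_lt i j -> is_zero (f j)) -> Acc exp_lt f.
Proof.
elim/(well_founded_ind (@wo_lt_wf b)): i f => i IH.
apply: exp_acc_step => h zh.
have [hn0|h0] := pselect (exists j, ~ is_zero (h j)); last first.
  constructor=> g [k [gk _]]; have [zk|nzk] := pselect (is_zero (h k)).
    by case: (not_lt_zero zk gk).
  by case: h0; exists k.
have [m nzm mP] := finite_wo_max (exp_fin h) hn0.
apply: (IH m); first by apply/negP => /zh.
by move=> j mj; apply: contrapT => /mP jm; move: mj; rewrite /wo_lt jm.
Qed.

Lemma exp_lt_wf : well_founded exp_lt.
Proof.
move=> f; have [fn0|f0] := pselect (exists j, ~ is_zero (f j)); last first.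
  constructor=> g [k [gk _]]; have [zk|nzk] := pselect (is_zero (f k)).
    by case: (not_lt_zero zk gk).
  by case: f0; exists k.
have [m nzm mP] := finite_wo_max (exp_fin f) fn0.
apply: (@exp_acc_bounded m) => j mj.
by apply: contrapT => /mP jm; move: mj; rewrite /wo_lt jm.
Qed.

Lemma exp_lt_asym (f g : exp_sort) : exp_lt f g -> exp_lt g f -> False.
Proof.
elim/(well_founded_ind exp_lt_wf): f g => f IH g fg gf.
exact: (IH g gf f gf fg).
Qed.

Lemma exp_leP : well_order exp_le.
Proof.
apply: antisymmetric_well_order.
  move=> f g /andP[/asboolP[//|fg] /asboolP[//|gf]].
  by case: (exp_lt_asym fg gf).
move=> A [f Af]; apply: contrapT => NA.
elim/(well_founded_ind exp_lt_wf): f Af => f IH Af.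
apply: NA; exists f; split=> // g Ag; apply/asboolP.
by case: (exp_total f g) => [->|fg|gf]; [left|right|case: (IH g gf Ag)].
Qed.

Definition wo_exp : wellOrder := WellOrder exp_leP.

End Exponentiation.

Definition cantor : Type := nat -> bool.

Definition interleave (x y : cantor) : cantor :=
  fun n => if odd n then y n./2 else x n./2.

Variant tape := Input | Scratch | Output.

Variant move := MoveLeft | MoveRight.

(* [delta q s] is the instruction obeyed in state [q] when the head reads [s]:
   the next state, the symbols written on the three tapes, and the direction of
   the move.  The instructions for the halt state are never obeyed. *)
Record machine := Machine {
  state : finType;
  start_state : state;
  limit_state : state;
  halt_state : state;
  special_uniq : uniq [:: start_state; limit_state; halt_state];
  delta : state -> (tape -> bool) -> state * (tape -> bool) * move
}.

Record config (T : machine) := Config {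
  cstate : state T;
  chead : nat;
  cell : tape -> nat -> bool
}.

Section Computation.
Variable T : machine.

Definition init (x : cantor) : config T :=
  Config (start_state T) 0
    (fun t n => if t is Input then x n else false).

(* A move to the left from the leftmost cell leaves the head there. *)
Definition step (c : config T) : config T :=
  let: (q, w, m) := delta (cstate c) (fun t => cell c t (chead c)) in
  Config q (if m is MoveLeft then (chead c).-1 else (chead c).+1)
    (fun t n => if n == chead c then w t else cell c t n).

(* For a sequence of bits, limsup_(a < l) s a = 1 iff s a = 1 for cofinally
   many a < l. *)
Definition is_limsup (W : wellOrder) (l : W) (s : W -> bool) (v : bool) : Prop :=
  v <-> forall a, wo_lt a l -> exists b, [/\ wo_le a b, wo_lt b l & s b].

(* [c a] is the configuration at stage [a], before the instruction of that
   stage is obeyed.  Stages past the first one in the halt state are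
   immaterial: see [halts_at]. *)
Definition is_run (x : cantor) (W : wellOrder) (c : W -> config T) : Prop :=
  [/\ forall a, is_zero a -> c a = init x,
      forall a b, is_succ a b -> c b = step (c a) &
      forall l, is_limit l ->
        [/\ cstate (c l) = limit_state T, chead (c l) = 0 &
            forall t n, is_limsup l (fun a => cell (c a) t n) (cell (c l) t n)]].

Definition halts_at (x : cantor) (W : wellOrder) (a : W) (out : cantor) : Prop :=
  exists c : W -> config T,
    [/\ is_run x c, cstate (c a) = halt_state T,
        forall b, wo_lt b a -> cstate (c b) <> halt_state T &
        cell (c a) Output = out].

(* The number 1 as a content of the output tape: 1 0 0 0 ... *)
Definition one : cantor := fun n => n == 0.

Definition accepts (x : cantor) : Prop :=
  exists (W : wellOrder) (a : W), halts_at x a one.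

Definition halts_before (x : cantor) (W : wellOrder) (b : W) : Prop :=
  exists (a : W) (out : cantor), wo_lt a b /\ halts_at x a out.

End Computation.

(* [NP_ W] is NP_alpha for alpha the order type of [W]. *)
Definition NP_ (W : wellOrder) : set (set cantor) :=
  [set A | exists (T : machine) (b : W),
    (forall x, A x <-> exists y, accepts T (interleave x y)) /\
    (forall z, halts_before T z b)].

Definition NP : set (set cantor) := NP_ (wo_exp wo_omega wo_omega).

Definition coNP : set (set cantor) := [set A | NP (~` A)].

(* Main.v *)
From HB Require Import structures.
From mathcomp Require Import all_boot.
From mathcomp Require Import boolp classical_sets cardinality.
From mathcomp Require Import zify.
Require Import Defs.

Set Implicit Arguments.
Unset Strict Implicit.
Unset Printing Implicit Defensive.

Local Open Scope classical_set_scope.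

(** The proof is a diagonalization between two facts about NP.

    Upper bound: every set in NP is a projection of a closed subset of 2^omega
    x omega^omega ([NP_analytic]). All computations of the machine stop before
    one fixed countable stage. By induction on the stage, each datum of the
    configuration reached there (the state, the head position, one bit of a
    tape) is a property of the input that is analytic together with its
    complement: a step inspects a bounded part of the configuration, and the
    limsup at a limit stage is a countable combination of earlier data
    ([holds_run_bianalytic]). Analytic sets are closed under countable unions,
    countable intersections and projections along 2^omega.

    Lower bound: read x as a graph on omega, and let [clique_set] be the set of
    the graphs that have an infinite clique. It is in NP: given a set y of
    vertices on the side, a machine runs through the pairs q <= j and sets a
    flag whenever y contains j and all members of y up to j, including j, are
    adjacent to j. Any two such vertices j are adjacent, and if y is a clique,
    then all its members are such vertices; so for some y the flag is raised
    infinitely often iff there is an infinite clique, and the limsup rule turns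
    this into one bit of the output at stage omega ([clique_acceptsE]); the
    machine halts at stage omega + 1 on every input.

    Diagonalization: a tree has an infinite branch iff its comparability graph
    has an infinite clique, so for a closed P there is a graph that has an
    infinite clique iff some f satisfies P. Here the tree may depend on the
    real to which P is applied, and it may be taken to be the graph itself,
    because an edge depends on earlier bits only. So every closed P has a real
    c such that c has an infinite clique iff P c f holds for some f
    ([diagonal_clique]). If the complement of [clique_set] were in NP, it would
    be given by a closed P, and its c would be in [clique_set] iff it is not.
    *)

(** * Comparing stages in different well-orders *)

Section Stages.
Implicit Types W V : wellOrder.

Lemma wo_lt_irr W (a : W) : ~~ wo_lt a a.
Proof. by rewrite /wo_lt wo_refl. Qed.

Definition bisimulation W V (R : W -> V -> Prop) : Prop :=
  forall a v, R a v ->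
    (forall b, wo_lt b a -> exists2 u, wo_lt u v & R b u) /\
    (forall u, wo_lt u v -> exists2 b, wo_lt b a & R b u).

(** The stages a of W and v of V have the same order type below them. Since
    both orders are well-founded, this amounts to the existence of a
    bisimulation. *)
Definition same_stage W V (a : W) (v : V) : Prop :=
  exists2 R : W -> V -> Prop, bisimulation R & R a v.

Lemma same_stage_below W V (a : W) (v : V) b :
  same_stage a v -> wo_lt b a -> exists2 u, wo_lt u v & same_stage b u.
Proof.
move=> [R bR Rav] ba; have [+ _] := bR _ _ Rav.
by move=> /(_ _ ba)[u uv Rbu]; exists u => //; exists R.
Qed.

Lemma same_stage_sym W V (a : W) (v : V) : same_stage a v -> same_stage v a.
Proof.
move=> [R bR Rav]; exists (fun v a => R a v) => // {Rav}v {}a Rav.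
by have [? ?] := bR _ _ Rav.
Qed.

Lemma same_stage_inj W V (a b : W) (v : V) :
  same_stage a v -> same_stage b v -> a = b.
Proof.
elim/(well_founded_ind (@wo_lt_wf W)): a b v => a IH b v av bv.
case: (wo_ltgtE a b) => [ab|//|ba]; last exact/esym/(IH b ba a v).
have [u uv au] := same_stage_below bv ab.
have [a1 a1a ua1] := same_stage_below (same_stage_sym av) uv.
have a1E : a1 = a by apply: (IH a1 a1a _ u) => //; apply: same_stage_sym.
by move: a1a; rewrite a1E (negbTE (wo_lt_irr a)).
Qed.

Lemma same_stage_mono W V (a b : W) (v u : V) :
  same_stage a v -> same_stage b u -> wo_lt a b -> wo_lt v u.
Proof.
move=> av bu ab; have [w wu aw] := same_stage_below bu ab.
by rewrite (same_stage_inj (same_stage_sym av) (same_stage_sym aw)).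
Qed.

Lemma same_stage_trichotomy W V (a : W) (v : V) :
  [\/ same_stage a v, exists2 b, wo_lt b a & same_stage b v
    | exists2 u, wo_lt u v & same_stage a u].
Proof.
elim/(well_founded_ind (@wo_lt_wf W)): a v => a IHa v.
elim/(well_founded_ind (@wo_lt_wf V)): v => v IHv.
have [|Nb] := pselect (exists2 b, wo_lt b a & same_stage b v).
  by constructor 2.
have [|Nu] := pselect (exists2 u, wo_lt u v & same_stage a u).
  by constructor 3.
constructor 1.
exists (fun b u => same_stage b u \/ b = a /\ u = v); last by right.
move=> b u [bu|[-> ->]]; split.
- move=> d db; have [w wu dw] := same_stage_below bu db.
  by exists w => //; left.
- move=> w wu; have [d db dw] := same_stage_below (same_stage_sym bu) wu.
  by exists d => //; left; apply: same_stage_sym.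
- move=> d da; case: (IHa d da v) => [dv|[e ed ev]|[w wv dw]].
  + by case: Nb; exists d.
  + by case: Nb; exists e => //; apply: wo_lt_le_trans ed (wo_ltW da).
  + by exists w => //; left.
- move=> w wv; case: (IHv w wv) => [aw|[d da dw]|[e ew ae]].
  + by case: Nu; exists w.
  + by exists d => //; left.
  + by case: Nu; exists e => //; apply: wo_lt_le_trans ew (wo_ltW wv).
Qed.

Lemma same_stage_zero W V (a : W) (v : V) :
  same_stage a v -> is_zero a -> is_zero v.
Proof.
move=> av za u; apply: contrapT => /negP uv.
have [b] := same_stage_below (same_stage_sym av) uv.
by rewrite /wo_lt za.
Qed.

Lemma same_stage_succ W V (a b : W) (v u : V) :
  same_stage a v -> same_stage b u -> is_succ a b -> is_succ v u.
Proof.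
move=> av bu [ab abP]; split; first exact: same_stage_mono ab.
move=> w vw; apply: contrapT => /negP wu.
have [d db wd] := same_stage_below (same_stage_sym bu) wu.
have := abP d (same_stage_mono (same_stage_sym av) wd vw).
by apply/negP.
Qed.

Lemma same_stage_limit W V (l : W) (m : V) :
  same_stage l m -> is_limit l -> is_limit m.
Proof.
move=> lm [Nz Ns]; split.
  by move=> zm; apply/Nz/same_stage_zero/zm/same_stage_sym.
move=> v vm; have [vltm _] := vm.
have [a al va] := same_stage_below (same_stage_sym lm) vltm.
exact/(Ns a)/(same_stage_succ va (same_stage_sym lm)).
Qed.

(** Half of the invariance of a limsup; the other half is this lemma for the
    converse correspondence of stages. *)
Lemma limit_stages_limsup W V (l : W) (m : V) (s : W -> bool) (s' : V -> bool) :
  same_stage l m ->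
  (forall b w, wo_lt b l -> same_stage b w -> s b = s' w) ->
  (forall a, wo_lt a l -> exists b, [/\ wo_le a b, wo_lt b l & s b]) ->
  forall u, wo_lt u m -> exists w, [/\ wo_le u w, wo_lt w m & s' w].
Proof.
move=> lm ss' H u um.
have [a al ua] := same_stage_below (same_stage_sym lm) um.
have [b [ab bl sb]] := H a al.
have [w wm bw] := same_stage_below lm bl.
exists w; split=> //; last by rewrite -(ss' b w).
apply: contraTT ab => wu; exact: (same_stage_mono (same_stage_sym bw) ua wu).
Qed.

Variable T : machine.

Lemma config_ext (c d : config T) : cstate c = cstate d -> chead c = chead d ->
  (forall t n, cell c t n = cell d t n) -> c = d.
Proof.
case: c d => [s h f] [s' h' f'] /= -> -> E; congr Config.
by apply/funext => t; apply/funext.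
Qed.

Lemma same_stage_run (x : cantor) W V (c : W -> config T) (d : V -> config T) :
  is_run x c -> is_run x d -> forall a v, same_stage a v -> c a = d v.
Proof.
move=> [c0 cS cL] [d0 dS dL] a.
elim/(well_founded_ind (@wo_lt_wf W)): a => a IH v av.
have [za|Nza] := pselect (is_zero a).
  by rewrite c0 // d0 //; apply: same_stage_zero za.
have [[b ba]|Nsa] := pselect (exists b, is_succ b a).
  have [blta _] := ba; have [u uv bu] := same_stage_below av blta.
  by rewrite (cS b) // (dS u) ?(IH b _ u) //; apply: same_stage_succ ba.
have la : is_limit a by split=> // b ba; apply: Nsa; exists b.
have [cs ch cc] := cL a la.
have [ds dh dc] := dL v (same_stage_limit av la).
apply: config_ext; rewrite ?cs ?ds ?ch ?dh // => t n.
have E b w : wo_lt b a -> same_stage b w -> cell (c b) t n = cell (d w) t n.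
  by move=> ba bw; rewrite (IH b ba w).
apply/idP/idP.
  by move=> /(cc t n) H; apply/(dc t n); apply: limit_stages_limsup av E H.
move=> /(dc t n) H; apply/(cc t n).
apply: limit_stages_limsup (same_stage_sym av) _ H => b w bv bw.
have [e ea /same_stage_sym eb] := same_stage_below (same_stage_sym av) bv.
have <- := same_stage_inj eb (same_stage_sym bw).
exact/esym/E.
Qed.

(** Acceptance quantifies over all well-orders; this reduces it to the run
    along one that is long enough: of two halting stages neither can come
    strictly first, so they correspond to each other and carry the same
    configuration. *)
Lemma halts_at_uniq x W V (a : W) (v : V) out out' :
  @halts_at T x W a out -> @halts_at T x V v out' -> out = out'.
Proof.
move=> [c [rc ca Nc <-]] [d [rd dv Nd <-]].
have E := same_stage_run rc rd.
case: (same_stage_trichotomy a v) => [/E->//|[b ba /E cb]|[u uv /E cu]].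
  by case: (Nc b ba); rewrite cb.
by case: (Nd u uv); rewrite -cu.
Qed.

(** * Existence of runs *)

Lemma wo_recursion W (A : Type) (a0 : A) (G : W -> (W -> A) -> A) :
  (forall a c d, (forall b, wo_lt b a -> c b = d b) -> G a c = G a d) ->
  exists c : W -> A, forall a, c a = G a c.
Proof.
move=> GE.
pose F a (rec : forall b : W, wo_lt b a -> A) :=
  G a (fun b => if pselect (wo_lt b a) is left ba then rec b ba else a0).
pose c := Fix (@wo_lt_wf W) (fun=> A) F; exists c => a.
rewrite /c Fix_eq -/c.
  by apply: GE => b ba; case: pselect.
move=> d r r' rr'; apply: GE => b bd; case: pselect => // ?; exact: rr'.
Qed.

Lemma run_exists W x : exists c : W -> config T, is_run x c.
Proof.
pose G a (c : W -> config T) : config T :=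
  if pselect (is_zero a) then init T x else
  if pselect (exists b, is_succ b a) is left e then step (c (projT1 (cid e)))
  else Config (limit_state T) 0 (fun t n =>
    `[< forall b, wo_lt b a ->
          exists d, [/\ wo_le b d, wo_lt d a & cell (c d) t n] >]).
have [|c cE] := wo_recursion (init T x) (G := G).
  move=> a c d cd; rewrite /G; case: (pselect (is_zero a)) => [//|/= _].
  case: (pselect (exists b, is_succ b a)) => [e|/= _].
    by rewrite cd //; case: cid => b bs /=; case: bs.
  congr Config; apply/funext => t; apply/funext => n; apply: asbool_equiv_eq.
  by split=> H b /H[e [be ea ce]]; exists e; split; rewrite // ?cd // -cd.
exists c; split.
- by move=> a za; rewrite cE /G; case: pselect.
- move=> a b ab; have [altb abP] := ab; rewrite cE /G.
  case: pselect => [zb|/= _].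
    by move: altb; rewrite /wo_lt zb.
  case: pselect => [e|[]]; last by exists a.
  case: cid => d [db dP] /=; congr (step (c _)); apply: wo_anti.
    by apply: contraTT db => ad; rewrite /wo_lt abP.
  by apply: contraTT altb => da; rewrite /wo_lt dP.
- move=> l [Nz Ns]; rewrite cE /G; case: pselect => //= _.
  case: pselect => [[b /Ns]//|/= _]; split=> // t n; rewrite /is_limsup /=.
  by split=> [/asboolP|H]; last apply/asboolP.
Qed.

End Stages.

(** * The first stages of omega ^ omega *)

Section OmegaPowOmega.
Local Notation W := (wo_exp wo_omega wo_omega).

Lemma omega_zeroP (n : wo_omega) : is_zero n <-> n = 0.
Proof. by split=> [/(_ 0)|-> m //]; rewrite /= leqn0 => /eqP. Qed.

Lemma finite_support_nth (s : seq nat) :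
  finite_set [set i : wo_omega | ~ is_zero (nth 0 s i : wo_omega)].
Proof.
apply: sub_finite_set (finite_II (size s)) => i /= Nz.
by rewrite ltnNge; apply/negP => si; apply/Nz/omega_zeroP; rewrite nth_default.
Qed.

(** The ordinal sum of omega ^ i * s_i, the higher powers coming first. *)
Definition omega_poly (s : seq nat) : W := ExpSort (finite_support_nth s).

Lemma omega_poly_surj (f : W) : exists s, omega_poly s = f.
Proof.
have [N NP] : exists N, forall i, N <= i -> f i = 0 :> nat.
  have [[i Ni]|N] := pselect (exists i, ~ is_zero (f i)); last first.
    exists 0 => i _; apply: contrapT => Nz.
    by apply: N; exists i => /omega_zeroP.
  have [m _ mP] := finite_wo_max (exp_fin f) (ex_intro _ i Ni : _ !=set0).
  exists m.+1 => j mj; apply: contrapT => Nz.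
  by have := mP j; rewrite /= leqNgt mj => H; apply/notF/H => /omega_zeroP.
exists (mkseq f N); apply: exp_ext => i /=.
have [iN|Ni] := ltnP i N; first by rewrite nth_mkseq.
by rewrite nth_default ?size_mkseq // NP.
Qed.

Lemma exp_ltP (f g : W) : wo_lt f g <-> exp_lt f g.
Proof.
rewrite /wo_lt /= /exp_le; split.
  by move=> /asboolP N; case: (exp_total f g) => // H; case: N; [left|right].
move=> fg; apply/asboolP => -[gf|/(exp_lt_asym fg)//].
by apply: (exp_lt_asym fg); rewrite gf in fg *.
Qed.

Lemma omega_poly_zero : is_zero (omega_poly [::]).
Proof.
move=> f; apply: contrapT => /negP/exp_ltP[i [+ _]].
by rewrite /wo_lt /= nth_nil.
Qed.

Lemma omega_poly_succ n s :
  is_succ (omega_poly (n :: s)) (omega_poly (n.+1 :: s)).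
Proof.
split.
  by apply/exp_ltP; exists 0; split=> [|[]//]; rewrite /wo_lt /= -ltnNge.
move=> f /exp_ltP[i [lt eq]]; rewrite /= /exp_le; apply/asboolP.
move: i lt eq => [|i] /= lt eq; last first.
  by right; exists i.+1; split=> // -[//|j]; apply: (eq j.+1).
move: lt; rewrite /wo_lt /= -ltnNge leq_eqVlt => /orP[/eqP fE|lt].
  by left; apply: exp_ext => -[|i] //=; rewrite -eq.
right; exists 0; split=> [|[|j]// j0]; first by rewrite /wo_lt /= -ltnNge.
by rewrite -eq.
Qed.

Definition omega : W := omega_poly [:: 0; 1].

Lemma lt_omegaP (f : W) : wo_lt f omega <-> exists n, f = omega_poly [:: n].
Proof.
split=> [/exp_ltP[i [lt eq]]|[n ->]]; last first.
  apply/exp_ltP; exists 1; split=> //= -[|[|j]]//= _.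
  by rewrite nth_nil.
have iE : i = 1.
  by case: i {eq} lt => [|[|k]] //; rewrite /wo_lt /= ?nth_nil.
rewrite iE in lt eq; exists (f 0); apply: exp_ext => -[|[|k]]//=.
  by move: lt; rewrite /wo_lt /= -ltnNge ltnS leqn0 => /eqP.
by rewrite eq //= nth_nil.
Qed.

Lemma omega_poly1_zero : is_zero (omega_poly [:: 0]).
Proof.
suff -> : omega_poly [:: 0] = omega_poly [::] by exact: omega_poly_zero.
by apply: exp_ext => -[|[|i]].
Qed.

Lemma lt_omega_poly1 n m :
  wo_lt (omega_poly [:: n]) (omega_poly [:: m]) = (n < m).
Proof.
apply/idP/idP => [/exp_ltP[[|i] []]|nm]; rewrite /wo_lt /= -?ltnNge //.
  by rewrite nth_nil.
by apply/asboolP => -[/(congr1 (fun f : W => f 0)) /= E|[[|i] []]];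
  rewrite /wo_lt /= ?nth_nil // -?ltnNge; lia.
Qed.

Lemma omega_limit : is_limit omega.
Proof.
split=> [z|a [/lt_omegaP[n ->]]].
  have : wo_lt (omega_poly [:: 0]) omega by apply/lt_omegaP; exists 0.
  by rewrite /wo_lt z.
have : wo_lt (omega_poly [:: n.+1]) omega by apply/lt_omegaP; exists n.+1.
move=> nw /(_ (omega_poly [:: n.+1])); rewrite lt_omega_poly1 => /(_ (leqnn _)).
by apply/negP.
Qed.

Variable T : machine.

Lemma run_finite_stage (x : cantor) (c : W -> config T) n : is_run x c ->
  c (omega_poly [:: n]) = iter n (@step T) (init T x).
Proof.
move=> [c0 cS _]; elim: n => [|n IH] /=.
  by rewrite c0 //; exact: omega_poly1_zero.
by rewrite (cS (omega_poly [:: n])) ?IH //; exact: omega_poly_succ.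
Qed.

Lemma run_omega (x : cantor) (c : W -> config T) : is_run x c ->
  [/\ cstate (c omega) = limit_state T, chead (c omega) = 0 &
    forall t n, cell (c omega) t n <->
      forall i, exists2 j, i <= j & cell (iter j (@step T) (init T x)) t n].
Proof.
move=> rc; have [_ _ /(_ _ omega_limit)[cs ch cc]] := rc; split=> // t n.
split=> [/(cc t n) H i|H].
  have /H[b [ib /lt_omegaP[j bj] cj]] : wo_lt (omega_poly [:: i]) omega.
    by apply/lt_omegaP; exists i.
  rewrite bj in ib cj; exists j; last by rewrite -(run_finite_stage _ rc).
  by rewrite leqNgt -lt_omega_poly1 /wo_lt ib.
apply/(cc t n) => a /lt_omegaP[i ->]; have [j ij cj] := H i.
exists (omega_poly [:: j]); split; last by rewrite (run_finite_stage _ rc).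
  by apply: contraTT ij => ji; rewrite -ltnNge -lt_omega_poly1.
by apply/lt_omegaP; exists j.
Qed.

End OmegaPowOmega.

(** * Analytic sets *)

Definition agree (A : Type) (n : nat) (g h : nat -> A) : Prop :=
  forall m, m < n -> g m = h m.

(** P is closed in 2^omega x omega^omega, in terms of limits: it holds at every
    point that is approximated by points where it holds. *)
Definition limit_closed (P : cantor -> (nat -> nat) -> Prop) : Prop :=
  forall x f,
    (forall n, exists x' f', [/\ agree n x' x, agree n f' f & P x' f']) ->
    P x f.

Definition analytic (B : cantor -> Prop) : Prop :=
  exists2 P, limit_closed P & forall x, B x <-> exists f, P x f.

Definition bianalytic (B : cantor -> Prop) : Prop :=
  analytic B /\ analytic (fun x => ~ B x).

Definition enumerable (I : Type) : Prop :=
  exists e : nat -> I, forall i, exists n, e n = i.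

Lemma countType_enumerable (I : countType) (i0 : I) : enumerable I.
Proof.
exists (fun n => odflt i0 (unpickle n)) => i; exists (pickle i).
by rewrite pickleK.
Qed.

Lemma omega_pow_omega_enumerable : enumerable (wo_exp wo_omega wo_omega).
Proof.
have [e eP] := countType_enumerable [::] : enumerable (seq nat).
exists (fun n => omega_poly (e n)) => f.
by have [s <-] := omega_poly_surj f; have [n <-] := eP s; exists n.
Qed.

Section AnalyticSets.
Implicit Types B C : cantor -> Prop.

Lemma analytic_ext B C : (forall x, B x <-> C x) -> analytic B -> analytic C.
Proof. by move=> BC [P clP BP]; exists P => // x; rewrite -BC. Qed.

Lemma bianalytic_ext B C :
  (forall x, B x <-> C x) -> bianalytic B -> bianalytic C.
Proof.
by move=> BC [aB anB]; split; [move: aB|move: anB];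
  apply: analytic_ext => x; rewrite BC.
Qed.

Lemma analytic_cst (Q : Prop) : analytic (fun=> Q).
Proof.
exists (fun _ _ => Q) => [x f /(_ 0)[_ [_ []]]//|x].
by split=> [q|[]//]; exists id.
Qed.

Lemma analytic_bit n b : analytic (fun x => x n = b).
Proof.
exists (fun x _ => x n = b) => [x f /(_ n.+1)[x' [_ [<- //]]]|x].
by split=> [q|[]//]; exists id.
Qed.

Lemma common_bound (phi : nat -> nat) n :
  exists2 N, n <= N & forall m, m < n -> phi m < N.
Proof.
exists (n + \max_(m < n) (phi m).+1); first exact: leq_addr.
move=> m mn; apply: leq_trans (leq_addl _ _).
exact: (leq_bigmax (Ordinal mn)).
Qed.

(** Reindexing f is continuous: the first n values of the result are determined
    by finitely many values of f. *)
Lemma limit_closed_reindex P (phi : nat -> nat) :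
  limit_closed P -> limit_closed (fun x f => P x (f \o phi)).
Proof.
move=> clP x f H; apply: clP => n; have [N nN phiN] := common_bound phi n.
have [x' [f' [xx' ff' Pxf]]] := H N; exists x', (f' \o phi); split=> //.
  by move=> m mn; apply/xx'/(leq_trans mn).
by move=> m mn; apply/ff'/phiN.
Qed.

(** A witness for all the sets at once interleaves countably many witnesses. *)
Lemma analytic_bigcap_nat (B : nat -> cantor -> Prop) :
  (forall i, analytic (B i)) -> analytic (fun x => forall i, B i x).
Proof.
move=> aB; have [P PP] : {P : nat -> cantor -> (nat -> nat) -> Prop & forall i,
    limit_closed (P i) /\ forall x, B i x <-> exists f, P i x f}.
  apply: (@choice _ _ (fun i P => limit_closed P /\
    forall x, B i x <-> exists f, P x f)) => i.
  by have [P clP BP] := aB i; exists P.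
exists (fun x f => forall i, P i x (f \o (fun m => pickle (i, m)))).
  move=> x f H i; have [clP _] := PP i.
  apply: (limit_closed_reindex (phi := fun m => pickle (i, m)) clP) => n.
  by have [x' [f' [xx' ff' Pxf]]] := H n; exists x', f'.
move=> x; split=> [Bx|[f Pf] i]; last by apply/(PP i).2; eexists; apply: Pf.
have [f fP] : {f : nat -> nat -> nat & forall i, P i x (f i)}.
  by apply: (@choice _ _ (fun i f => P i x f)) => i; apply/(PP i).2.
exists (fun k => if unpickle k is Some (i, m) then f i m else 0) => i.
suff <- : f i = (fun k => if unpickle k is Some (i, m) then f i m else 0)
  \o (fun m => pickle (i, m)) by [].
by apply/funext => m /=; rewrite pickleK.
Qed.

(** The first value of the witness names the set to which the point belongs. *)
Lemma analytic_bigcup_nat (B : nat -> cantor -> Prop) :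
  (forall i, analytic (B i)) -> analytic (fun x => exists i, B i x).
Proof.
move=> aB; have [P PP] : {P : nat -> cantor -> (nat -> nat) -> Prop & forall i,
    limit_closed (P i) /\ forall x, B i x <-> exists f, P i x f}.
  apply: (@choice _ _ (fun i P => limit_closed P /\
    forall x, B i x <-> exists f, P x f)) => i.
  by have [P clP BP] := aB i; exists P.
exists (fun x f => P (f 0) x (f \o succn)).
  move=> x f H; have [clP _] := PP (f 0).
  apply: (limit_closed_reindex (phi := succn) clP) => n.
  have [x' [f' [xx' ff' Pxf]]] := H n.+1; exists x', f'.
  rewrite -(ff' 0) //; split=> // m mn; [apply: xx'|apply: ff'];
    exact: leq_trans mn (leqnSn _).
move=> x; split=> [[i /(PP i).2[f Pf]]|[f Pf]]; last first.
  by exists (f 0); apply/(PP _).2; eexists; apply: Pf.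
by exists (fun k => if k is m.+1 then f m else i).
Qed.

Lemma analytic_forall (I : Type) (B : I -> cantor -> Prop) : enumerable I ->
  (forall i, analytic (B i)) -> analytic (fun x => forall i, B i x).
Proof.
move=> [e eP] aB; apply: analytic_ext (analytic_bigcap_nat (fun n => aB (e n))).
by move=> x; split=> // H i; have [n <-] := eP i.
Qed.

Lemma analytic_exists (I : Type) (B : I -> cantor -> Prop) : enumerable I ->
  (forall i, analytic (B i)) -> analytic (fun x => exists i, B i x).
Proof.
move=> [e eP] aB; apply: analytic_ext (analytic_bigcup_nat (fun n => aB (e n))).
move=> x; split=> [[n Bn]|[i]]; first by exists (e n).
by have [n <-] := eP i; exists n.
Qed.

Lemma bianalytic_not B : bianalytic B -> bianalytic (fun x => ~ B x).
Proof.
move=> [aB anB]; split=> //; apply: analytic_ext aB => x.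
by split=> [Bx|]; [apply|apply: contrapT].
Qed.

Lemma bianalytic_exists (I : Type) (B : I -> cantor -> Prop) : enumerable I ->
  (forall i, bianalytic (B i)) -> bianalytic (fun x => exists i, B i x).
Proof.
move=> eI aB; split; first by apply: analytic_exists => // i; case: (aB i).
have := analytic_forall eI (fun i => (aB i).2); apply: analytic_ext => x.
by split=> [N [i /N]|N i Bi] //; apply: N; exists i.
Qed.

Lemma bianalytic_forall (I : Type) (B : I -> cantor -> Prop) : enumerable I ->
  (forall i, bianalytic (B i)) -> bianalytic (fun x => forall i, B i x).
Proof.
move=> eI aB.
have := bianalytic_not (bianalytic_exists eI (fun i => bianalytic_not (aB i))).
apply: bianalytic_ext => x; split=> [N i|H [i]//].
by apply: contrapT => Ni; apply: N; exists i.
Qed.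

Lemma bianalytic_and B C :
  bianalytic B -> bianalytic C -> bianalytic (fun x => B x /\ C x).
Proof.
move=> aB aC.
apply: (@bianalytic_ext (fun x => forall b : bool, (if b then B else C) x)).
  move=> x; split=> [H|[? ?] []//].
  by split; [apply: (H true)|apply: (H false)].
by apply: bianalytic_forall => [|[]//]; exact: countType_enumerable true.
Qed.

Lemma bianalytic_cst (Q : Prop) : bianalytic (fun=> Q).
Proof. by split; apply: analytic_cst. Qed.

Lemma bianalytic_imply (Q : Prop) B :
  bianalytic B -> bianalytic (fun x => Q -> B x).
Proof.
move=> aB; have [q|Nq] := pselect Q.
  by apply: bianalytic_ext aB => x; split=> // /(_ q).
by apply: bianalytic_ext (bianalytic_cst True) => x; split.
Qed.

Lemma bianalytic_bit n : bianalytic (fun x => x n).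
Proof.
split; first exact: analytic_ext (analytic_bit n true).
by apply: analytic_ext (analytic_bit n false) => x; split=> [->|/negP/negbTE].
Qed.

Lemma bianalytic_eq (s : cantor -> bool) b :
  bianalytic (fun x => s x) -> bianalytic (fun x => s x = b).
Proof.
case: b => [//|] /bianalytic_not; apply: bianalytic_ext => x.
by split=> [/negP/negbTE|->].
Qed.

Lemma analytic_project B :
  analytic B -> analytic (fun x => exists y, B (interleave x y)).
Proof.
move=> [P clP BP].
exists (fun x f =>
  P (interleave x (fun n => f n.*2 != 0)) (fun n => f n.*2.+1)).
  move=> x f H; apply: clP => n.
  have [x' [f' [xx' ff' Pxf]]] := H n.*2.
  exists (interleave x' (fun n => f' n.*2 != 0)), (fun n => f' n.*2.+1).
  split=> // m mn; rewrite /interleave; last by apply: ff'; lia.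
  by case: ifP => _; [rewrite ff' //|apply: xx']; lia.
move=> x; split=> [[y /BP[f Pf]]|[f Pf]]; last first.
  by exists (fun n => f n.*2 != 0); apply/BP; eexists; exact: Pf.
exists (fun n => if odd n then f n./2 else y n./2 : nat).
have -> : (fun n => (if odd n.*2 then f n.*2./2 else y n.*2./2 : nat) != 0) = y.
  by apply/funext => n; rewrite odd_double doubleK; case: (y n).
suff -> : (fun n => if odd n.*2.+1 then f n.*2.+1./2 else y n.*2.+1./2 : nat)
  = f.
  by [].
by apply/funext => n; rewrite /= odd_double /= uphalf_double.
Qed.

End AnalyticSets.

(** * Nondeterministic acceptance before a countable stage is analytic *)

Variant datum (T : machine) :=
  StateIs (q : state T) | HeadAt (k : nat) | CellOn (t : tape) (n : nat).

Definition holds (T : machine) (c : config T) (d : datum T) : Prop :=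
  match d with
  | StateIs q => cstate c = q
  | HeadAt k => chead c = k
  | CellOn t n => cell c t n
  end.

Section Accepting.
Variables (T : machine) (W : wellOrder).
Hypothesis eW : enumerable W.
Implicit Types c : config T.

Definition scanned (w : bool * bool * bool) (t : tape) : bool :=
  match t with Input => w.1.1 | Scratch => w.1.2 | Output => w.2 end.

Definition local_view := (state T * nat * (bool * bool * bool))%type.

Definition has_view (c : config T) (v : local_view) : Prop :=
  [/\ holds c (StateIs v.1.1), holds c (HeadAt T v.1.2) &
      forall t, cell c t v.1.2 = scanned v.2 t].

Lemma has_view_exists c : exists v, has_view c v.
Proof.
exists (cstate c, chead c, (cell c Input (chead c), cell c Scratch (chead c),
  cell c Output (chead c))).
by split=> // -[].
Qed.

Definition step_holds (c : config T) (v : local_view) (d : datum T) : Prop :=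
  let: (q, w, m) := delta v.1.1 (scanned v.2) in
  match d with
  | StateIs q' => q = q'
  | HeadAt k => (if m is MoveLeft then v.1.2.-1 else v.1.2.+1) = k
  | CellOn t n => if n == v.1.2 then w t : Prop else cell c t n
  end.

(** The datum d after a step is a function of the view before the step, or, for
    a cell away from the head, the same datum before the step. There are
    countably many views, so this expresses d by a countable disjunction. *)
Lemma holds_step c d :
  holds (step c) d <-> exists v, has_view c v /\ step_holds c v d.
Proof.
have E v : has_view c v -> step_holds c v d <-> holds (step c) d.
  move=> [cs ch cc]; rewrite /step_holds /step.
  have -> : (fun t => cell c t (chead c)) = scanned v.2.
    by apply/funext => t; rewrite ch cc.
  rewrite cs ch; case: (delta _ _) => -[q w] m.
  by case: d => //= t n; case: ifP.
split=> [H|[v [cv /E]]]; last exact.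
by have [v cv] := has_view_exists c; exists v; split=> //; apply/E.
Qed.

Lemma holds_run_bianalytic (c : cantor -> W -> config T) :
  (forall z, is_run z (c z)) ->
  forall a d, bianalytic (fun z => holds (c z a) d).
Proof.
move=> rc a; elim/(well_founded_ind (@wo_lt_wf W)): a => a IH d.
have [za|Nza] := pselect (is_zero a).
  have E z : c z a = init T z by have [c0 _ _] := rc z; apply: c0.
  case: d => [q|k|[] n].
  - apply: bianalytic_ext (bianalytic_cst (start_state T = q)) => z.
    by rewrite E.
  - by apply: bianalytic_ext (bianalytic_cst (0 = k)) => z; rewrite E.
  - by apply: bianalytic_ext (bianalytic_bit n) => z; rewrite E.
  - by apply: bianalytic_ext (bianalytic_cst false) => z; rewrite E.
  - by apply: bianalytic_ext (bianalytic_cst false) => z; rewrite E.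
have [[b ba]|Nsa] := pselect (exists b, is_succ b a).
  have {}IH := IH b ba.1.
  have E z : c z a = step (c z b) by have [_ cS _] := rc z; apply: cS.
  apply: (@bianalytic_ext (fun z => exists v,
    has_view (c z b) v /\ step_holds (c z b) v d)) => [z|].
    by rewrite E; apply: iff_sym; apply: holds_step.
  apply: bianalytic_exists => [|v].
    exact: countType_enumerable (start_state T, 0, (true, true, true)).
  apply: bianalytic_and; last first.
    rewrite /step_holds; case: (delta _ _) => -[q w] m.
    case: d => [q'|k|t n]; try exact: bianalytic_cst.
    case: (n == _); [exact: bianalytic_cst|exact: (IH (CellOn T t n))].
  apply: (@bianalytic_ext (fun z => holds (c z b) (StateIs v.1.1) /\
    (holds (c z b) (HeadAt T v.1.2) /\
      (cell (c z b) Input v.1.2 = scanned v.2 Input /\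
      (cell (c z b) Scratch v.1.2 = scanned v.2 Scratch /\
       cell (c z b) Output v.1.2 = scanned v.2 Output))))) => [z|].
    by split=> [[? [? [? [? ?]]]]|[? ? H]]; split=> // -[].
  apply: bianalytic_and; first exact: IH.
  apply: bianalytic_and; first exact: IH.
  by do ?apply: bianalytic_and; apply: bianalytic_eq; apply: IH (CellOn T _ _).
have la : is_limit a by split=> // b ba; apply: Nsa; exists b.
have E z : [/\ cstate (c z a) = limit_state T, chead (c z a) = 0 &
    forall t n, is_limsup a (fun a => cell (c z a) t n) (cell (c z a) t n)].
  by have [_ _ cL] := rc z; apply: cL.
case: d => [q|k|t n].
- apply: bianalytic_ext (bianalytic_cst (limit_state T = q)) => z.
  by have [/= -> _ _] := E z.
- apply: bianalytic_ext (bianalytic_cst (0 = k)) => z.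
  by have [/= _ -> _] := E z.
apply: (@bianalytic_ext (fun z => forall b, wo_lt b a ->
    exists d, (wo_le b d /\ wo_lt d a) /\ holds (c z d) (CellOn T t n))).
  move=> z; have [_ _ /(_ t n) H] := E z.
  split=> [K|/H K b /K[d [bd da cd]]]; last by exists d.
  by apply/H => b /K[d [[bd da] cd]]; exists d.
apply: bianalytic_forall => // b; apply: bianalytic_imply.
apply: bianalytic_exists => // d; have [da|Nda] := pselect (wo_lt d a).
  by apply: bianalytic_and; [exact: bianalytic_cst|exact: IH].
by apply: bianalytic_ext (bianalytic_cst False) => z; split=> // -[[]].
Qed.

(** Acceptance asks for some stage of W at which the run halts for the first
    time with the right output. The run may be followed along W because it
    halts there on every input. *)
Lemma accepts_bianalytic (b : W) :
  (forall z, halts_before T z b) -> bianalytic (accepts T).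
Proof.
move=> hb; have [c rc] := choice (@run_exists T W).
have cP := holds_run_bianalytic rc.
apply: (@bianalytic_ext (fun z => exists a, cstate (c z a) = halt_state T /\
  ((forall d, wo_lt d a -> cstate (c z d) <> halt_state T) /\
   forall n, cell (c z a) Output n = one n))).
  move=> z; split=> [[a [ca [Nc out]]]|[V [v hv]]].
    by exists W, a, (c z); split=> //; apply/funext.
  have [a [out [_ ha]]] := hb z.
  have outE := halts_at_uniq ha hv; have [d [rd da Nd dout]] := ha.
  have -> : c z = d.
    apply/funext => e; apply: (same_stage_run (rc z) rd).
    by exists eq => // u _ <-; split=> w wu; exists w.
  by exists a; split=> //; split=> // n; rewrite dout outE.
apply: bianalytic_exists => // a.
apply: bianalytic_and; first exact: (cP a (StateIs _)).
apply: bianalytic_and.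
  apply: bianalytic_forall => // d; apply/bianalytic_imply/bianalytic_not.
  exact: (cP d (StateIs _)).
apply: bianalytic_forall => [|n]; first exact: (countType_enumerable 0).
by apply: bianalytic_eq; apply: (cP a (CellOn T Output n)).
Qed.

End Accepting.

Lemma NP_analytic (A : set cantor) : NP A -> analytic A.
Proof.
move=> [T [b [AP hb]]].
have [aT _] := accepts_bianalytic omega_pow_omega_enumerable hb.
by apply: analytic_ext (analytic_project aT) => x; rewrite AP.
Qed.

(** * A machine searching for infinite cliques *)

(** The input z is cut into pairs of cells: z (2 q + 1) tells whether the
    vertex q is chosen, and z (2 (k + 1)) whether the k-th pair of vertices is
    an edge. The pairs (q, j) with q <= j come in the order (0, 0), (0, 1), (1,
    1), (0, 2), ...

    The scratch tape marks the left end of the tape, the cell of the vertex q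
    (odd) and the cell of the next edge to be read (even); since the head meets
    them in this order, all searches are for the next mark. The output tape
    marks the vertex j, whose mark only moves to the right, so that it
    disappears at stage omega; cell 0 of the output tape is the flag.

    The boolean g of the states tells whether all chosen vertices before q are
    adjacent to j; b is the edge bit, and k the next value of the flag. [Step1]
    and [Step2] advance the edge mark, [Leftward] searches for the vertex q. If
    q < j, then [Row1] and [Row2] pass to q + 1; otherwise [Column1] and
    [Column2] pass to j + 1, [Home] sets the flag, and [Reset] returns q to 0.
    [Rightward] searches for the edge mark and reads the bit there. [Start],
    [PutFirst] and [ReadFirst] put the first marks and read the first edge. *)
Inductive clique_state :=
  | Start | PutFirst | ReadFirst
  | Step1 of bool & bool | Step2 of bool & bool | Leftward of bool & bool
  | Row1 of bool | Row2 of bool | Column1 of bool | Column2 of bool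
  | Home of bool | Reset | Rightward of bool | AtLimit | Halt.

Definition encode_state (q : clique_state) : 'I_15 * bool * bool :=
  let e i (lt : i < 15) g b := (Ordinal lt, g, b) in
  match q with
  | Start => e 0 isT true true | PutFirst => e 1 isT true true
  | ReadFirst => e 2 isT true true | Step1 g b => e 3 isT g b
  | Step2 g b => e 4 isT g b | Leftward g b => e 5 isT g b
  | Row1 g => e 6 isT g g | Row2 g => e 7 isT g g
  | Column1 k => e 8 isT k k | Column2 k => e 9 isT k k
  | Home k => e 10 isT k k | Reset => e 11 isT true true
  | Rightward g => e 12 isT g g | AtLimit => e 13 isT true true
  | Halt => e 14 isT true true
  end.

Definition decode_state (p : 'I_15 * bool * bool) : option clique_state :=
  let: (i, g, b) := p in
  match val i with
  | 0 => Some Start | 1 => Some PutFirst | 2 => Some ReadFirst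
  | 3 => Some (Step1 g b) | 4 => Some (Step2 g b) | 5 => Some (Leftward g b)
  | 6 => Some (Row1 g) | 7 => Some (Row2 g)
  | 8 => Some (Column1 g) | 9 => Some (Column2 g) | 10 => Some (Home g)
  | 11 => Some Reset | 12 => Some (Rightward g) | 13 => Some AtLimit
  | _ => Some Halt
  end.

Lemma encode_stateK : pcancel encode_state decode_state.
Proof. by case. Qed.

HB.instance Definition _ := Finite.copy clique_state (pcan_type encode_stateK).

(** The instruction in state q on the symbols i, s, o; the symbols written are
    those for scratch and output, as the input is never changed. *)
Definition act (q : clique_state) (i s o : bool) :
    clique_state * (bool * bool) * move :=
  match q with
  | Start => (PutFirst, (true, o), MoveRight)
  | PutFirst => (ReadFirst, (true, true), MoveRight)
  | ReadFirst => (Step1 true i, (s, o), MoveRight)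
  | Step1 g b => (Step2 g b, (s, o), MoveRight)
  | Step2 g b => (Leftward g b, (true, o), MoveLeft)
  | Leftward g b =>
      if ~~ s then (Leftward g b, (s, o), MoveLeft)
      else if o then (Column1 (g && (i ==> b) && i), (false, false), MoveRight)
      else (Row1 (g && (i ==> b)), (false, o), MoveRight)
  | Row1 g => (Row2 g, (s, o), MoveRight)
  | Row2 g => (Rightward g, (true, o), MoveRight)
  | Column1 k => (Column2 k, (s, o), MoveRight)
  | Column2 k => (Home k, (s, true), MoveLeft)
  | Home k =>
      if ~~ s then (Home k, (s, o), MoveLeft) else (Reset, (s, k), MoveRight)
  | Reset => (Rightward true, (true, o), MoveRight)
  | Rightward g =>
      if ~~ s then (Rightward g, (s, o), MoveRight)
      else (Step1 g i, (false, o), MoveRight)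
  | AtLimit | Halt => (Halt, (s, o), MoveRight)
  end.

Definition clique_machine : machine.
Proof.
apply: (@Machine clique_state Start AtLimit Halt _
  (fun q r => let: (q', (s, o), m) := act q (r Input) (r Scratch) (r Output) in
     (q', fun t => match t with
       Input => r Input | Scratch => s | Output => o end, m))).
by [].
Defined.

Section CliqueMachine.
Local Notation M := clique_machine.

Definition conf (q : clique_state) (h : nat) (z s o : nat -> bool) : config M :=
  @Config M q h (fun t => match t with
    Input => z | Scratch => s | Output => o end).

Definition upd (s : nat -> bool) h v : nat -> bool :=
  fun n => if n == h then v else s n.

Lemma upd_id s h : upd s h (s h) = s.
Proof. by apply/funext => n; rewrite /upd; case: eqP => [->|]. Qed.

Lemma step_conf q h z s o : step (conf q h z s o) =
  let: (q', (a, b), m) := act q (z h) (s h) (o h) in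
  conf q' (if m is MoveLeft then h.-1 else h.+1) z (upd s h a) (upd o h b).
Proof.
rewrite /step /=; case: (act _ _ _ _) => -[q' [a b]] m /=.
by apply: config_ext => // -[] n //=; case: eqP => [->|].
Qed.

Implicit Types (ok : pred nat) (s o : nat -> bool) (g f : bool).
Variable z : cantor.
Local Notation edge k := (z k.+1.*2).
Local Notation vertex q := (z q.*2.+1).

Definition outputs_in (ok : pred nat) (c : config M) : Prop :=
  forall n, cell c Output n -> ok n.

(** Besides the final configuration, the ones on the way matter: the limsup
    sees all of them. *)
Definition path_in (ok : pred nat) (c d : config M) : Prop :=
  exists2 N, iter N (@step M) c = d &
    forall i, i < N -> outputs_in ok (iter i (@step M) c).

Lemma path_refl ok c : path_in ok c c.
Proof. by exists 0. Qed.

Lemma path_trans ok c d e : path_in ok c d -> path_in ok d e -> path_in ok c e.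
Proof.
move=> [N cd Nok] [N' de N'ok]; exists (N' + N); first by rewrite iterD cd.
move=> i iN; have [/Nok//|Ni] := ltnP i N.
by rewrite -(subnK Ni) iterD cd; apply: N'ok; lia.
Qed.

Lemma path_step ok q h s o d :
  (forall n, o n -> ok n) ->
  path_in ok (step (conf q h z s o)) d -> path_in ok (conf q h z s o) d.
Proof.
move=> oko; apply: path_trans; exists 1 => // i.
rewrite ltnS leqn0 => /eqP -> n.
exact: oko.
Qed.

Lemma walk_left ok q a h s o :
  (forall n, o n -> ok n) ->
  (forall i b, act q i false b = (q, (false, b), MoveLeft)) ->
  a <= h -> (forall m, a < m <= h -> s m = false) ->
  path_in ok (conf q h z s o) (conf q a z s o).
Proof.
move=> oko qL; elim: h => [|h IH].
  by rewrite leqn0 => /eqP-> _; exact: path_refl.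
rewrite leq_eqVlt => /orP[/eqP-> _|ah s0]; first exact: path_refl.
apply: path_step => //; rewrite step_conf s0 ?ah ?leqnn // qL /=.
rewrite -{1}(s0 h.+1) ?ah ?leqnn // !upd_id; apply: IH => // m /andP[am mh].
by rewrite s0 // am ltnW.
Qed.

Lemma walk_right ok q a h s o :
  (forall n, o n -> ok n) ->
  (forall i b, act q i false b = (q, (false, b), MoveRight)) ->
  h <= a -> (forall m, h <= m < a -> s m = false) ->
  path_in ok (conf q h z s o) (conf q a z s o).
Proof.
move=> oko qR ha; have [d ->] : exists d, a = d + h.
  by exists (a - h); rewrite subnK.
elim: d h {ha} => [|d IH] h s0.
  exact: path_refl.
apply: path_step => //; rewrite step_conf s0 ?leqnn; last lia.
rewrite qR /= -{1}(s0 h) ?leqnn; last lia.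
rewrite !upd_id addSnnS; apply: IH => m hm; apply: s0; lia.
Qed.

Definition marks q k : nat -> bool :=
  fun n => [|| n == 0, n == q.*2.+1 | n == k.+2.*2].

Definition outmarks (f : bool) j : nat -> bool :=
  fun n => if n == 0 then f else n == j.*2.+1.

Arguments marks : simpl never.
Arguments outmarks : simpl never.

(** The state of affairs when the k-th edge bit has been read and its mark
    moved to the next edge. *)
Definition ready g q k f j : config M :=
  conf (Leftward g (edge k)) k.*2.+3 z (marks q k) (outmarks f j).

Ltac tape_eq := apply/funext => ?; rewrite /upd /marks /outmarks;
  repeat case: eqP => ?; rewrite ?orbT //=; lia.

(** The return to the edge mark, common to both kinds of rounds. *)
Lemma fetch_edge ok g h q k f j :
  (forall n, outmarks f j n -> ok n) -> q.*2.+1 < h -> h <= k.+2.*2 ->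
  path_in ok (conf (Rightward g) h z (marks q k) (outmarks f j))
    (ready g q k.+1 f j).
Proof.
move=> oko qh hk.
apply: path_trans (walk_right oko _ hk _) _ => // [m hm|].
  by rewrite /marks; lia.
apply: path_step => //; rewrite step_conf.
have -> : marks q k k.+2.*2 by rewrite /marks eqxx !orbT.
rewrite /= upd_id.
apply: path_step => //; rewrite step_conf /= !upd_id.
apply: path_step => //; rewrite step_conf /= !upd_id.
suff -> : upd (upd (marks q k) k.+2.*2 false) k.+2.*2.+2 true = marks q k.+1.
  exact: path_refl.
by tape_eq.
Qed.

Lemma ready_row ok g q k f j :
  (forall n, outmarks f j n -> ok n) -> q < j <= k ->
  path_in ok (ready g q k f j)
    (ready (g && (vertex q ==> edge k)) q.+1 k.+1 f j).
Proof.
move=> oko /andP[qj jk].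
apply: path_trans (walk_left (a := q.*2.+1) oko _ _ _) _ => // [|m hm|].
- by lia.
- by rewrite /marks; lia.
apply: path_step => //; rewrite step_conf.
have -> : marks q k q.*2.+1 by rewrite /marks eqxx !orbT.
have oF : outmarks f j q.*2.+1 = false by rewrite /outmarks /=; lia.
rewrite /= oF; have -> : upd (outmarks f j) q.*2.+1 false = outmarks f j.
  by rewrite -[in LHS]oF upd_id.
apply: path_step => //; rewrite step_conf /= !upd_id.
apply: path_step => //; rewrite step_conf /= !upd_id.
have -> : upd (upd (marks q k) q.*2.+1 false) q.*2.+3 true = marks q.+1 k.
  by tape_eq.
by apply: fetch_edge => //; lia.
Qed.

(** Cell 0 of the output tape changes in such a round, which is why both the
    old and the new flag are allowed there. *)
Lemma ready_column ok g k f j (f' := g && (vertex j ==> edge k) && vertex j) :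
  (forall n, [|| (n == 0) && (f || f'), n == j.*2.+1 | n == j.*2.+3] -> ok n) ->
  j <= k -> path_in ok (ready g j k f j) (ready true 0 k.+1 f' j.+1).
Proof.
move=> okP jk.
have ok1 n : outmarks f j n -> ok n.
  by move=> H; apply: okP; move: H; rewrite /outmarks; case: (n == 0) => /= ->;
    rewrite ?orbT.
apply: path_trans (walk_left (a := j.*2.+1) ok1 _ _ _) _ => // [|m hm|].
- by lia.
- by rewrite /marks; lia.
apply: path_step => //; rewrite step_conf.
have -> : marks j k j.*2.+1 by rewrite /marks eqxx !orbT.
have -> : outmarks f j j.*2.+1 by rewrite /outmarks /=.
rewrite /= -/f'; set s := upd (marks j k) _ _; set o := upd (outmarks f j) _ _.
have ok2 n : o n -> ok n by rewrite /o /upd; case: eqP => // _; apply: ok1.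
apply: path_step => //; rewrite step_conf /= !upd_id.
apply: path_step => //; rewrite step_conf /= !upd_id.
have -> : upd o j.*2.+3 true = outmarks f j.+1 by rewrite /o; tape_eq.
have ok3 n : outmarks f j.+1 n -> ok n.
  by move=> H; apply: okP; move: H; rewrite /outmarks doubleS;
    case: (n == 0) => /= ->; rewrite ?orbT.
apply: path_trans (walk_left (a := 0) ok3 _ _ _) _ => // [m hm|].
  by rewrite /s /upd /marks; case: eqP => // ?; lia.
apply: path_step => //; rewrite step_conf.
have s0 : s 0 by [].
rewrite /= s0; have -> : upd s 0 true = s by rewrite -[in LHS]s0 upd_id.
have -> : upd (outmarks f j.+1) 0 f' = outmarks f' j.+1 by tape_eq.
have ok4 n : outmarks f' j.+1 n -> ok n.
  by move=> H; apply: okP; move: H; rewrite /outmarks doubleS;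
    case: (n == 0) => /= ->; rewrite ?orbT.
apply: path_step => //; rewrite step_conf /= !upd_id.
have -> : upd s 1 true = marks 0 k by rewrite /s; tape_eq.
by apply: fetch_edge.
Qed.

Definition next_pair (p : nat * nat) : nat * nat :=
  if p.1 == p.2 then (0, p.2.+1) else (p.1.+1, p.2).

Definition pair_at k : nat * nat := iter k next_pair (0, 0).

Local Notation row k := (pair_at k).1.
Local Notation col k := (pair_at k).2.

(** [good], [hit] and [flag] follow the booleans of the machine: the tests
    passed in column col k before round k, the outcome of a round that ends a
    column, and the outcome of the last column completed before round k. *)
Fixpoint good k : bool :=
  if k is k'.+1 then
    if row k' == col k' then true
    else good k' && (vertex (row k') ==> edge k')
  else true.

Definition hit k : bool :=
  [&& row k == col k, good k && (vertex (row k) ==> edge k) & vertex (row k)].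

Fixpoint flag k : bool :=
  if k is k'.+1 then if row k' == col k' then hit k' else flag k' else false.

Lemma pair_at_le k : row k <= col k <= k.
Proof.
elim: k => [//|k IH]; rewrite /pair_at /= -/(pair_at k) /next_pair.
by case: eqP => /= ?; lia.
Qed.

Lemma col_step k : col k.+1 = if row k == col k then (col k).+1 else col k.
Proof. by rewrite /pair_at /= -/(pair_at k) /next_pair; case: ifP. Qed.

Lemma row_step k : row k.+1 = if row k == col k then 0 else (row k).+1.
Proof. by rewrite /pair_at /= -/(pair_at k) /next_pair; case: ifP. Qed.

Lemma col_mono k k' : k <= k' -> col k <= col k'.
Proof.
move=> /subnK <-; elim: (k' - k) => [//|d IH].
by rewrite addSn col_step; case: ifP => _; lia.
Qed.

Lemma pair_at_surj q j : q <= j -> exists k, pair_at k = (q, j).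
Proof.
elim: j q => [|j IH] q; first by rewrite leqn0 => /eqP ->; exists 0.
elim: q => [_|q IHq qj].
  have [k kE] := IH j (leqnn _).
  by exists k.+1; rewrite /pair_at /= -/(pair_at k) kE /next_pair /= eqxx.
have [k kE] := IHq (ltnW qj).
exists k.+1; rewrite /pair_at /= -/(pair_at k) kE /next_pair /=.
by rewrite ltn_eqF.
Qed.

Lemma col_unbounded n : exists k, n <= col k.
Proof. by have [k kE] := pair_at_surj (leqnn n); exists k; rewrite kE. Qed.

Definition stage_config k : config M :=
  ready (good k) (row k) k (flag k) (col k).

Definition round_ok k : pred nat := fun n =>
  [|| (n == 0) && (flag k || flag k.+1), n == (col k).*2.+1
    | n == (col k.+1).*2.+1].

Lemma round k : path_in (round_ok k) (stage_config k) (stage_config k.+1).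
Proof.
have /andP[rc ck] := pair_at_le k.
rewrite /stage_config /round_ok row_step col_step /= /hit.
case: eqP rc => [E _|/eqP NE rc]; last first.
  apply: ready_row; last by rewrite ltn_neqAle NE rc.
  by move=> [|n]; rewrite /outmarks /= ?orbb; case: (flag k) => //= ->.
by rewrite !E; apply: ready_column.
Qed.

Lemma initial_path : exists2 N, iter N (@step M) (init M z) = stage_config 0 &
  forall i, i < N -> outputs_in (pred1 1) (iter i (@step M) (init M z)).
Proof.
have -> : init M z = conf Start 0 z (fun=> false) (fun=> false).
  by apply: config_ext => // -[].
suff [N ? ?] : path_in (pred1 1) (conf Start 0 z (fun=> false) (fun=> false))
  (stage_config 0) by exists N.
apply: path_step => //; rewrite step_conf /=.
apply: path_step => [n|]; first by rewrite /upd; case: eqP.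
rewrite step_conf /=; set o := upd (upd _ 0 false) 1 true.
have oE : o = outmarks false 0 by rewrite /o; tape_eq.
have oko n : o n -> pred1 1 n by rewrite oE /outmarks; case: (n == 0).
do 3![apply: path_step => //; rewrite step_conf /= ?upd_id].
rewrite oE; set s := upd _ 4 true.
have -> : s = marks 0 0 by rewrite /s; tape_eq.
exact: path_refl.
Qed.

Lemma path_pos ok c d : c <> d -> path_in ok c d ->
  exists N, [/\ 0 < N, iter N (@step M) c = d &
    forall i, i < N -> outputs_in ok (iter i (@step M) c)].
Proof. by move=> cd [[|N] cdN Nok]; [case: (cd cdN)|exists N.+1]. Qed.

Lemma stage_config_neq k : stage_config k <> stage_config k.+1.
Proof. by move=> /(congr1 (@chead M)) [] /eqP; rewrite -!mul2n; lia. Qed.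

Lemma schedule : exists t : nat -> nat,
  [/\ forall i, i < t 0 ->
        outputs_in (pred1 1) (iter i (@step M) (init M z)),
      forall k, t k < t k.+1,
      forall k, iter (t k) (@step M) (init M z) = stage_config k &
      forall k i, t k <= i < t k.+1 ->
        outputs_in (round_ok k) (iter i (@step M) (init M z))].
Proof.
have [t0 t0E t0ok] := initial_path.
have [d dP] := choice (fun k => path_pos (@stage_config_neq k) (round k)).
pose t := fix t k := if k is k'.+1 then d k' + t k' else t0.
have tE k : iter (t k) (@step M) (init M z) = stage_config k.
  by elim: k => [//|k IH] /=; rewrite iterD IH; have [] := dP k.
exists t; split=> // k; first by have [] := dP k; rewrite /=; lia.
move=> i /andP[ti] /=; have [_ _ H] := dP k => id.
by rewrite -(subnK ti) iterD tE; apply: H; lia.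
Qed.

(** During a round, cell 0 holds the flag from before or after it, and any
    other cell of the output tape is 0 once the mark of the column has passed
    it. *)
Lemma output_limsup n :
  (forall i, exists2 j, i <= j & cell (iter j (@step M) (init M z)) Output n)
  <-> n = 0 /\ forall i, exists2 k, i <= k & flag k.
Proof.
have [t [_ tS tE tok]] := schedule.
have tmono k : k <= t k by elim: k => [//|k IH]; apply: leq_ltn_trans (tS k).
split=> [H|[-> H] i]; last first.
  have [k ik fk] := H i; exists (t k); first exact: leq_trans (tmono k).
  by rewrite tE.
have {}H K : exists2 k, K <= k & round_ok k n.
  have [j Kj cj] := H (t K).
  suff [k Kk kj] : exists2 k, K <= k & t k <= j < t k.+1.
    by exists k => //; exact: tok kj _ cj.
  elim: j Kj {cj} => [|j IH]; first by exists K => //; have := tS K; lia.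
  rewrite leq_eqVlt => /orP[/eqP <-|/IH[k Kk kj]].
    by exists K; rewrite ?leqnn ?tS.
  have [|kj'] := ltnP j.+1 (t k.+1); first by exists k => //; lia.
  by exists k.+1; [lia|have := tS k.+1; lia].
have [K0 nK0] := col_unbounded n.
have {}H K : K0 <= K -> exists2 k, K <= k & (n == 0) && (flag k || flag k.+1).
  move=> KK; have [k Kk /or3P ok] := H K; exists k => //.
  have := col_mono (leq_trans KK Kk); have := col_mono (leqnSn k).
  by case: ok => [//|/eqP|/eqP]; lia.
split=> [|i]; first by have [k _ /andP[/eqP]] := H K0 (leqnn _).
have [k Kk /andP[_ /orP[fk|fk]]] := H (maxn K0 i) (leq_maxl _ _).
  by exists k => //; lia.
by exists k.+1 => //; lia.
Qed.

Lemma never_halts n : cstate (iter n (@step M) (init M z)) <> Halt.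
Proof.
suff : cstate (iter n (@step M) (init M z)) \notin [:: AtLimit; Halt].
  by apply: contraNnot => ->.
elim: n => [//|n]; rewrite iterS; case: (iter n _ _) => q h c /=.
rewrite /step /=.
by case: q => //= *; do ?case: ifP.
Qed.

Local Notation W := (wo_exp wo_omega wo_omega).

Lemma lt_omega_succ (b : W) :
  wo_lt b (omega_poly [:: 1; 1]) -> wo_lt b omega \/ b = omega.
Proof.
move=> b1.
case: (wo_ltgtE b omega) => [|//|/(omega_poly_succ 0 [:: 1]).2]; auto.
by move: b1; rewrite /wo_lt => /negbTE ->.
Qed.

Lemma clique_halts_at : exists2 out, @halts_at M z W (omega_poly [:: 1; 1]) out
  & forall n, out n <-> n = 0 /\ forall i, exists2 k, i <= k & flag k.
Proof.
have [c rc] := run_exists M W z; have [cs ch cc] := run_omega rc.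
have [_ cS _] := rc; have cE := cS _ _ (omega_poly_succ 0 [:: 1]).
exists (cell (c (omega_poly [:: 1; 1])) Output); last first.
  move=> n; rewrite -output_limsup -cc cE /step cs /=.
  by case: eqP => [->|_].
exists c; split=> //; first by rewrite cE /step cs.
move=> b /lt_omega_succ[/lt_omegaP[n ->]|-> ]; last by rewrite cs.
by rewrite (run_finite_stage _ rc); exact: never_halts.
Qed.

Lemma clique_halts_before : @halts_before M z W (omega_poly [:: 2; 1]).
Proof.
have [out hout _] := clique_halts_at.
exists (omega_poly [:: 1; 1]), out; split=> //.
exact: (omega_poly_succ 1 [:: 1]).1.
Qed.

Lemma clique_accepts : accepts M z <-> forall i, exists2 k, i <= k & flag k.
Proof.
have [out hout outE] := clique_halts_at; split=> [[V [v hv]]|H].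
  by have /outE[] : out 0 by rewrite (halts_at_uniq hout hv).
exists W, (omega_poly [:: 1; 1]).
suff <- : out = one by [].
by apply/funext => n; apply/idP/eqP => [/outE[]|n0]; last by apply/outE.
Qed.

Lemma good_spec k : good k <->
  forall k', k' < k -> col k' = col k -> vertex (row k') -> edge k'.
Proof.
elim: k => [//|k IH]; rewrite col_step /=; case: eqP => _.
  split=> // _ k'; rewrite ltnS => /col_mono; lia.
split=> [/andP[/IH gk /implyP vk] k'|H].
  by rewrite ltnS leq_eqVlt => /orP[/eqP->|/gk].
apply/andP; split; last by apply/implyP/H.
by apply/IH => k' k'k; apply/H/ltnW.
Qed.

(** Only chosen vertices up to j are inspected, so these vertices j need not be
    all the chosen ones; but any two of them are adjacent. *)
Definition clique_vertex j : Prop := vertex j /\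
  forall k, col k = j -> vertex (row k) -> edge k.

Lemma hit_spec k : hit k <-> row k = col k /\ clique_vertex (col k).
Proof.
rewrite /hit /clique_vertex; split.
  move=> /and3P[/eqP E /andP[/good_spec gk /implyP vk] vr].
  rewrite -E; split=> //; split=> // k' k'E.
  case: (ltngtP k' k) => [lt|gt|->] //; first by apply: gk; rewrite // -E.
  have := col_mono gt; rewrite col_step E eqxx => H.
  by exfalso; move: k'E; rewrite E; lia.
move=> [E [vj H]]; rewrite E eqxx vj /= andbT; apply/andP; split.
  by apply/good_spec => k' _ ?; apply: H.
by apply: (H k _); rewrite // E.
Qed.

Lemma flag_last_hit k : flag k -> exists2 e, hit e & (col e).+1 = col k.
Proof.
elim: k => [//|k IH]; rewrite col_step /=; case: eqP => // _ hk.
by exists k.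
Qed.

Lemma infinite_flags : (forall i, exists2 k, i <= k & flag k) <->
  forall i, exists2 j, i <= j & clique_vertex j.
Proof.
split=> H i.
  have [k ik] := col_unbounded i.+1.
  have [k' kk' /flag_last_hit[e he ek]] := H k.
  exists (col e); last by have [] := (hit_spec e).1 he.
  have := col_mono kk'; lia.
have [j ij cj] := H i; have [k kE] := pair_at_surj (leqnn j).
have hk : hit k by apply/hit_spec; rewrite kE.
exists k.+1; last by rewrite /= kE eqxx.
by have := pair_at_le k; rewrite kE /=; lia.
Qed.

Lemma clique_acceptsE : accepts M z <->
  forall i, exists2 j, i <= j & clique_vertex j.
Proof. by rewrite clique_accepts infinite_flags. Qed.

End CliqueMachine.

(** * Diagonalization *)

Definition codes_prefix (f : nat -> nat) (j : nat) : Prop :=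
  exists n, j = pickle (mkseq f n).

(** The graph whose cliques are chains of the tree of all f with P c f: both
    ends are codes of prefixes of one f such that P holds at f and at some real
    that agrees with c below k. Asking for agreement below k only, instead of
    below the length of the prefixes, makes the k-th bit depend on earlier
    bits. The index is shifted because the machine finds the edge of the k-th
    pair in bit k + 1. *)
Definition diagonal_edge P k (c : cantor) : Prop :=
  exists x f, [/\ agree k x c, codes_prefix f (pair_at k.-1).1,
    codes_prefix f (pair_at k.-1).2 & P x f].

Lemma diagonal_code P :
  exists c : cantor, forall k, c k <-> diagonal_edge P k c.
Proof.
have [|c cE] := @wo_recursion wo_omega bool false
    (fun k c => `[< diagonal_edge P k c >]).
  move=> k c d cd; apply: asbool_equiv_eq.
  have {}cd m : m < k -> c m = d m.
    by move=> conf; apply: cd; rewrite /wo_lt /= -ltnNge.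
  by split=> -[x [f [xc rf cf Pxf]]]; exists x, f; split=> // m conf;
    rewrite xc // cd.
by exists c => k; rewrite cE; split=> [/asboolP//|]; move/asboolP.
Qed.

Lemma interleave_even x y n : interleave x y n.*2 = x n.
Proof. by rewrite /interleave odd_double doubleK. Qed.

Lemma interleave_odd x y n : interleave x y n.*2.+1 = y n.
Proof. by rewrite /interleave /= odd_double /= uphalf_double. Qed.

Lemma injective_unbounded (u : nat -> nat) : injective u ->
  forall i, exists n, i <= u n.
Proof.
move=> u_inj i; apply: contrapT => N.
have := @uniq_leq_size _ (map u (iota 0 i.+1)) (iota 0 i).
rewrite map_inj_uniq ?iota_uniq // size_map !size_iota ltnn => /(_ isT) H.
apply/notF/H => _ /mapP[n _ ->]; rewrite mem_iota /= add0n ltnNge.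
by apply/negP => ui; apply: N; exists n.
Qed.

Lemma inj_codes (f : nat -> nat) : injective (fun n => pickle (mkseq f n)).
Proof.
by move=> n m /(pcan_inj pickleK)/(congr1 size); rewrite !size_mkseq.
Qed.

Lemma prefix_eq (f g : nat -> nat) n m i : mkseq f n = mkseq g m ->
  i < n -> f i = g i.
Proof.
move=> E iN; have nm : n = m by rewrite -(size_mkseq f n) E size_mkseq.
by rewrite -(nth_mkseq 0 f iN) E nth_mkseq // -nm.
Qed.

(** The members of an infinite clique J code prefixes of unbounded lengths, any
    two of which are comparable, so their union is a sequence b. Members far
    out in J give points that satisfy P and agree with (c, b) on long initial
    segments, and P is closed. *)
Lemma branch_of_clique P (c : cantor) (J : nat -> Prop) : limit_closed P ->
  (forall i, exists2 j, i <= j & J j) ->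
  (forall i j, i <= j -> J i -> J j -> exists x f,
    [/\ agree j x c, codes_prefix f i, codes_prefix f j & P x f]) ->
  exists f, P c f.
Proof.
move=> clP Jinf Jpair.
(* distinct members of J code prefixes of distinct lengths *)
have long k : exists N, forall j (f : nat -> nat) n, N <= j -> J j ->
    j = pickle (mkseq f n) -> k <= n.
  elim: k => [|k [N NP]]; first by exists 0.
  have [[j [f [Nj Jj jE]]]|none] :=
      pselect (exists j (f : nat -> nat),
        [/\ N <= j, J j & j = pickle (mkseq f k)]).
    exists j.+1 => i g n ji Ji iE.
    have kn := NP i g n (leq_trans Nj (ltnW ji)) Ji iE.
    rewrite ltn_neqAle kn andbT; apply/eqP => kE; rewrite -{n}kE in iE kn.
    have [x [h [_ [a ja] [b ib] _]]] := Jpair j i (ltnW ji) Jj Ji.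
    have ka : mkseq f k = mkseq h a by apply: (pcan_inj pickleK); rewrite -jE.
    have kb : mkseq g k = mkseq h b by apply: (pcan_inj pickleK); rewrite -iE.
    have aE : a = k by rewrite -(size_mkseq h a) -ka size_mkseq.
    have bE : b = k by rewrite -(size_mkseq h b) -kb size_mkseq.
    by move: ji; rewrite ja ib aE bE ltnn.
  exists N => j f n Nj Jj jE; rewrite ltn_neqAle (NP j f n) // andbT.
  by apply/eqP => kE; apply: none; exists j, f; rewrite kE.
have /choice[j jP] k : exists j, J j /\
    exists (f : nat -> nat) n, j = pickle (mkseq f n) /\ k < n.
  have [N NP] := long k.+1; have [j Nj Jj] := Jinf N; exists j; split=> //.
  have [x [f [_ [n nE] _ _]]] := Jpair j j (leqnn j) Jj Jj.
  by exists f, n; split=> //; apply: NP nE.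
have [g gP] := choice (fun k => (jP k).2).
have [l lP] := choice gP.
pose b i := g i i.
(* any two members of J are prefixes of one sequence, hence of b *)
have comp (f : nat -> nat) n i m :
    J m -> m = pickle (mkseq f n) -> i < n -> f i = b i.
  move=> Jm mE iN; have [Ji _] := jP i; have [jE il] := lP i.
  have [h [p [q [mh ih]]]] : exists (h : nat -> nat) p q,
      m = pickle (mkseq h p) /\ j i = pickle (mkseq h q).
    case/orP: (leq_total m (j i)) => le.
      have [x [h [_ [p pE] [q qE] _]]] := Jpair _ _ le Jm Ji.
      by exists h, p, q.
    have [x [h [_ [p pE] [q qE] _]]] := Jpair _ _ le Ji Jm.
    by exists h, q, p.
  have mE' : mkseq f n = mkseq h p by apply: (pcan_inj pickleK); rewrite -mE.
  have iE' : mkseq (g i) (l i) = mkseq h q.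
    by apply: (pcan_inj pickleK); rewrite -jE.
  by rewrite (prefix_eq mE' iN) -(prefix_eq iE' il).
exists b; apply: clP => n; have [N NP] := long n.
have [m nm Jm] := Jinf (maxn n N).
have [x [f [xc _ [p mE] Pxf]]] := Jpair m m (leqnn m) Jm Jm.
exists x, f; split=> // i iN; first by apply: xc; apply: leq_trans iN _; lia.
by apply: (comp _ _ _ _ Jm mE); apply: leq_trans iN (NP m f p _ Jm mE); lia.
Qed.

Definition clique_set : set cantor :=
  [set x | exists y, accepts clique_machine (interleave x y)].

(** From left to right, the vertices on which the flag is raised form a clique.
    Conversely the codes of the prefixes of a witness f are a clique, the
    approximating real for each edge being c itself. *)
Lemma diagonal_clique P : limit_closed P ->
  exists c, clique_set c <-> exists f, P c f.
Proof.
move=> clP; have [c cE] := diagonal_code P; exists c.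
split=> [[y /clique_acceptsE H]|[f Pf]].
  pose J j := clique_vertex (interleave c y) j.
  apply: (branch_of_clique (J := J)) => // i j ij [+ _] [_ +].
  rewrite interleave_odd => yi.
  have [k kE] := pair_at_surj ij => /(_ k); rewrite kE.
  rewrite interleave_odd interleave_even => /(_ erefl yi)/cE.
  move=> [x [f [xc]]]; rewrite /= kE => fi fj Pxf; exists x, f; split=> //.
  move=> m mj; apply: xc; have := pair_at_le k; rewrite kE /=; lia.
exists (fun j => `[< codes_prefix f j >]); apply/clique_acceptsE => i.
have cP j : codes_prefix f j -> clique_vertex
    (interleave c (fun j => `[< codes_prefix f j >])) j.
  move=> fj; split; first by rewrite interleave_odd; apply/asboolP.
  move=> k kj; rewrite interleave_odd interleave_even => /asboolP fi.
  by apply/cE; exists c, f; split=> //=; rewrite kj.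
have [n ni] := injective_unbounded (@inj_codes f) i.
by exists (pickle (mkseq f n)) => //; apply: cP; exists n.
Qed.

Lemma clique_set_NP : NP clique_set.
Proof.
exists clique_machine, (omega_poly [:: 2; 1]); split=> // z.
exact: clique_halts_before.
Qed.

Theorem theorem3p2 : NP <> coNP.
Proof.
move=> E; have cD : coNP clique_set by rewrite -E; exact: clique_set_NP.
have [P clP PE] : analytic (~` clique_set) by exact: NP_analytic cD.
have [c cE] := diagonal_clique clP.
have : (~` clique_set) c <-> clique_set c := iff_trans (PE c) (iff_sym cE).
by rewrite /setC /=; tauto.
Qed.
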